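(* If $\kappa \geq \beth_\omega$ is a regular cardinal, then $\mathfrak{d}(\kappa) \leq \mathfrak{r}(\kappa)$.
   Context: For $f,g\in\kappa^\kappa$, $f \leq^* g$ means $|\{\alpha<\kappa : g(\alpha)<f(\alpha)\}|<\kappa$; $F\subseteq \kappa^\kappa$ is dominating if every $g \in \kappa^\kappa$ satisfies $g \leq^* f$ for some $f\in F$; $\mathfrak{d}(\kappa)$ is the least size of a dominating family. For $F \subseteq [\kappa]^\kappa$ and $B \subseteq \kappa$, $B$ reaps $F$ if $|A \cap B| = |A \cap (\kappa \setminus B)| = \kappa$ for every $A \in F$; $F$ is unreaped if no $B \subseteq \kappa$ reaps $F$; $\mathfrak{r}(\kappa)$ is the least size of an unreaped family in $[\kappa]^\kappa$. $\beth_\omega = \sup_n \beth_n$ where $\beth_0=\aleph_0$, $\beth_{n+1}=2^{\beth_n}$. *)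

(* Defs.v *)
From Stdlib Require Import Classical FunctionalExtensionality PropExtensionality.

Definition le_card (A B : Type) : Prop :=
  exists f : A -> B, forall x y, f x = f y -> x = y.

Fixpoint beth (n : nat) : Type :=
  match n with
  | O => nat
  | S m => beth m -> Prop
  end.

Definition strict_well_order (K : Type) (lt : K -> K -> Prop) : Prop :=
  (forall a, ~ lt a a) /\
  (forall a b c, lt a b -> lt b c -> lt a c) /\
  (forall a b, lt a b \/ a = b \/ lt b a) /\
  well_founded lt.

(* (K, lt) is a cardinal (initial ordinal) kappa: well-ordered and every
   proper initial segment has cardinality < |K| *)
Definition is_cardinal (K : Type) (lt : K -> K -> Prop) : Prop :=
  strict_well_order K lt /\
  (forall a : K, ~ le_card K {b : K | lt b a}).

(* regular: cf(kappa) = kappa, i.e. every unbounded subset has size kappa *)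
Definition is_regular_cardinal (K : Type) (lt : K -> K -> Prop) : Prop :=
  is_cardinal K lt /\
  (forall X : K -> Prop,
      (forall a : K, exists b, X b /\ ~ lt b a) -> le_card K {b : K | X b}).

Definition full_size (K : Type) (X : K -> Prop) : Prop := le_card K {a : K | X a}.

Definition leq_star (K : Type) (lt : K -> K -> Prop) (f g : K -> K) : Prop :=
  ~ full_size K (fun a => lt (g a) (f a)).

Definition dominating (K : Type) (lt : K -> K -> Prop)
  (F : (K -> K) -> Prop) : Prop :=
  forall g : K -> K, exists f, F f /\ leq_star K lt g f.

Definition reaps (K : Type) (F : (K -> Prop) -> Prop) (B : K -> Prop) : Prop :=
  forall A, F A ->
    full_size K (fun a => A a /\ B a) /\ full_size K (fun a => A a /\ ~ B a).

Definition unreaped_family (K : Type) (F : (K -> Prop) -> Prop) : Prop :=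
  (forall A, F A -> full_size K A) /\ ~ (exists B, reaps K F B).

(* Main.v *)
Require Import Defs.
From Stdlib Require Import List FinFun Lia Wellfounded.
From Stdlib Require Import ClassicalEpsilon FunctionalExtensionality.
From mathcomp Require Import ssreflect ssrfun ssrbool eqtype boolp wochoice.

Set Implicit Arguments.
Unset Strict Implicit.
Unset Printing Implicit Defensive.

(** Let F be unreaped and suppose that no family of functions indexed by F is
dominating.  For g : K -> K let E_g be the club of points closed under g and
f_g(c) = max (E_g cap [0, c]).  If g' >= g escapes the functions read off from
f_g[A] for A in F, then f_g' < f_g on unboundedly many points of every A in F;
so, F being unreaped, some A in F is almost contained in {f_g' < f_g}.
Iterating along a well-order of beth_(n+1) gives increasing functions g_x and
sets A_x in F.  A weak form of Shelah's revised GCH provides |F| many sets of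
size < beth_omega such that any beth_(n+1) members of F are covered by beth_n
of these sets; hence infinitely many A_x lie in one of them, S.  If g_0 was
chosen to escape the functions "every A in S has a point between b and h(b)",
there is an interval (b, g_0(b)) meeting these A_x, and every f_(g_x) is
constant on it; its values then decrease strictly in x, which is absurd.

The weak revised GCH is proved by induction on the cardinal A.  Call functions
F_a : T -> A, with a in A, different if any two agree only on a set in a given
sigma-ideal on T = beth_m; by a greedy construction, either there are A many
different functions below h, or A many functions catch every g < h on a
positive set.  If there are never A many different functions below a constant,
the ranges of the catching functions cover all bounded families.  Otherwise one
takes a minimal h with A many different functions F_a below it; the functions
below h are then caught by A many functions, and the induction hypothesis,
applied to each h(i), transfers to A through a |-> (i |-> F_a(i)). *)

(** * Greedy recursion, well-orderings and induction over cardinals *)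

Lemma wf_recursion (X V : Type) (lt : X -> X -> Prop) :
  well_founded lt ->
  forall Phi : forall x, (forall y, lt y x -> V) -> V,
  exists f : X -> V, forall x, f x = Phi x (fun y _ => f y).
Proof.
move=> wf Phi; exists (Fix wf (fun _ => V) Phi) => x.
rewrite Fix_eq // => y f g fg.
congr (Phi y _).
by apply: functional_extensionality_dep => z; apply: functional_extensionality => ?.
Qed.

(** Recursion takes [F x] in [Q] with every earlier value [R]-related to it, whenever such a point
    exists. The second case is a stage [x] at which there is none. *)
Lemma greedy (B T : Type) (lt : B -> B -> Prop) (Q : T -> Prop)
    (R : T -> T -> Prop) :
  well_founded lt -> inhabited T ->
  (exists F : B -> T, (forall x, Q (F x)) /\ forall x y, lt y x -> R (F y) (F x)) \/
  (exists (F : B -> T) x, forall g, Q g -> exists y, lt y x /\ ~ R (F y) g).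
Proof.
move=> wf iT.
have [F FE] := wf_recursion wf (fun x (rec : forall y, lt y x -> T) =>
  epsilon iT (fun g => Q g /\ forall y (h : lt y x), R (rec y h) g)).
have [all|/existsNP[x nx]] :=
    pselect (forall x, exists g, Q g /\ forall y, lt y x -> R (F y) g).
  left; exists F.
  have P x : Q (F x) /\ forall y, lt y x -> R (F y) (F x).
    by have := epsilon_spec iT _ (all x); rewrite -FE.
  by split=> [x|x y]; case: (P x) => // _; apply.
right; exists F, x => g Qg; apply: contrapT => h; apply: nx.
exists g; split=> // y yx; apply: contrapT => nR; apply: h; by exists y.
Qed.

Lemma le_card_refl A : le_card A A.
Proof. by exists id. Qed.

Lemma le_card_trans A B C : le_card A B -> le_card B C -> le_card A C.
Proof.
by move=> [f fI] [g gI]; exists (fun x => g (f x)) => x y /gI /fI.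
Qed.

Lemma le_card_surj A B (f : A -> B) : (forall b, exists a, f a = b) -> le_card B A.
Proof. by move=> /choice[g gK]; exists g => x y e; rewrite -(gK x) e gK. Qed.

Lemma le_card_range A B (f : A -> B) : le_card {b | exists a, f a = b} A.
Proof.
pose g a := exist (fun b => exists a, f a = b) (f a) (ex_intro _ a erefl).
by apply: (@le_card_surj _ _ g) => -[b [a e]]; exists a; apply: eq_exist.
Qed.

Lemma le_card_sub A B (P : A -> Prop) (Q : B -> Prop) (f : A -> B) :
  (forall x, P x -> Q (f x)) ->
  (forall x y, P x -> P y -> f x = f y -> x = y) ->
  le_card {x | P x} {y | Q y}.
Proof.
move=> fPQ fI.
exists (fun x : {x | P x} => exist Q (f (proj1_sig x)) (fPQ _ (proj2_sig x))).
by move=> [x Px] [y Py] [/(fI _ _ Px Py)] /= e; apply: eq_exist.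
Qed.

Lemma le_card_sig A (P : A -> Prop) : le_card {x | P x} A.
Proof. by exists (@proj1_sig _ _) => -[x Px] [y Py] /= e; apply: eq_exist. Qed.

Lemma le_card_inj_on A B (P : A -> Prop) : inhabited B ->
  le_card {x | P x} B ->
  exists f : A -> B, forall x y, P x -> P y -> f x = f y -> x = y.
Proof.
move=> [b] [f fI].
exists (fun x => match pselect (P x) with left h => f (exist _ x h) | right _ => b end).
move=> x y Px Py; case: pselect => // h; case: pselect => // h'.
by move=> /fI [].
Qed.

(** The well-ordering principle gives a reflexive relation with unique minima; totality,
    antisymmetry and transitivity are read off from the minima of sets of at most three points. *)
Lemma zermelo X : exists lt : X -> X -> Prop, strict_well_order X lt.
Proof.
have [R wR] := well_ordering_principle {classic X}.
have minP (P : X -> Prop) x : P x -> exists z, P z /\ forall y, P y -> R z y.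
  move=> Px; have [|z [[Pz zP] _]] := wR (fun x : {classic X} => `[< P x >]).
    by exists x; apply/asboolP.
  exists z; split=> [|y Py]; first by move/asboolP: Pz.
  by apply: zP; apply/asboolP.
have total (x y : X) : R x y \/ R y x.
  have [z [[->|->] h]] := minP (fun z => z = x \/ z = y) x (or_introl erefl).
    by left; apply: h; right.
  by right; apply: h; left.
have Rxx x : R x x by case: (total x x).
have anti (x y : X) : R x y -> R y x -> x = y.
  move=> xy yx.
  have [|w [[_ _] wU]] := wR (fun z : {classic X} => `[< z = x \/ z = y >]).
    by exists x; apply/asboolP; left.
  transitivity w; [symmetry|]; apply: wU; split.
  - by apply/asboolP; left.
  - by move=> z /asboolP[->|->].
  - by apply/asboolP; right.
  - by move=> z /asboolP[->|->].
exists (fun x y => R x y /\ x <> y); split; last split; last split.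
- by move=> a [].
- move=> a b c [ab nab] [bc nbc].
  have [z [hz zP]] := minP (fun z => z = a \/ z = b \/ z = c) a (or_introl erefl).
  have [za zb zc] : [/\ R z a, R z b & R z c] by split; apply: zP; tauto.
  case: hz => [e|[e|e]]; subst z.
  + split=> // e; subst c; exact: nab (anti _ _ ab bc).
  + by case: nab; apply: anti.
  + by case: nbc; apply: anti.
- move=> a b; have [->|nab] := pselect (a = b); first by right; left.
  by case: (total a b) => h; [left|right; right]; split=> // e; apply: nab.
- move=> a; apply: contrapT => na.
  have [z [nz zP]] := minP (fun z => ~ Acc (fun x y => R x y /\ x <> y) z) a na.
  apply: nz; constructor => y [yz nyz]; apply: contrapT => /zP zy.
  exact: nyz (anti _ _ yz zy).
Qed.

Lemma le_card_or_segment (B T : Type) (lt : B -> B -> Prop) :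
  well_founded lt -> (forall a b, lt a b \/ a = b \/ lt b a) ->
  le_card B T \/ exists x, le_card T {y | lt y x}.
Proof.
move=> wf tot.
have [iT|nT] := pselect (inhabited T); last first.
  have [[b]|nB] := pselect (inhabited B).
    by right; exists b; exists (fun t => False_rect _ (nT (inhabits t))) => t; case: nT.
  by left; exists (fun b => False_rect _ (nB (inhabits b))) => b; case: nB.
have [[F [_ FR]]|[F [x Fx]]] := greedy (fun _ : T => True) (fun a b => a <> b) wf iT.
  left; exists F => x y e; case: (tot x y) => [xy|[//|yx]].
    by case: (FR _ _ xy).
  by case: (FR _ _ yx).
right; exists x.
apply: (@le_card_surj _ _ (fun y => F (proj1_sig y))) => t.
have [y [yx /contrapT e]] := Fx t I.
by exists (exist _ y yx).
Qed.

Lemma le_card_total A B : le_card A B \/ le_card B A.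
Proof.
have [lt [_ [_ [tot wf]]]] := zermelo A.
have [|[x h]] := le_card_or_segment B wf tot; first by left.
right; apply: le_card_trans h (le_card_sig _).
Qed.

Lemma wf_min (X : Type) (lt : X -> X -> Prop) (P : X -> Prop) :
  well_founded lt -> (exists x, P x) ->
  exists x, P x /\ forall y, P y -> ~ lt y x.
Proof.
move=> wf [x Px]; apply: contrapT => h.
elim/(well_founded_ind wf): x Px => x IH Px; apply: h; exists x; split=> // y Py yx.
exact: IH y yx Py.
Qed.

Lemma segment_wo (X : Type) (lt : X -> X -> Prop) (a : X) :
  strict_well_order X lt ->
  strict_well_order {b | lt b a} (fun x y => lt (proj1_sig x) (proj1_sig y)).
Proof.
move=> [irr [tr [tot wf]]]; split; last split; last split.
- by move=> x; apply: irr.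
- by move=> x y z; apply: tr.
- move=> [x hx] [y hy] /=; case: (tot x y) => [|[e|]]; [by left| |by right; right].
  by right; left; apply: eq_exist.
- exact: (wf_inverse_image _ _ _ _ wf).
Qed.

(** A segment that injects into a shorter one is settled by the shorter one. Any other segment is
    itself a cardinal, and its own segments are, up to equipotence, segments of the whole order. *)
Lemma card_ind (Q : Type -> Prop) :
  (forall A B, le_card A B -> le_card B A -> Q A -> Q B) ->
  (forall A lt, is_cardinal A lt -> (forall a : A, Q {b | lt b a}) -> Q A) ->
  forall A, Q A.
Proof.
move=> Qeq Qcard A; have [lt wo] := zermelo A.
have [irr [tr [tot wf]]] := wo.
have Qseg a : Q {b | lt b a}.
  elim/(well_founded_ind wf): a => a IH.
  have [[a' [a'a h]]|na] :=
      pselect (exists a', lt a' a /\ le_card {b | lt b a} {b | lt b a'}).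
    apply: Qeq h (IH _ a'a); apply: (le_card_sub (f := id)) => // x xa'.
    exact: tr xa' a'a.
  have eqs (a' : {b | lt b a}) :
      le_card {b | lt b (proj1_sig a')}
        {b : {b | lt b a} | lt (proj1_sig b) (proj1_sig a')} /\
      le_card {b : {b | lt b a} | lt (proj1_sig b) (proj1_sig a')}
        {b | lt b (proj1_sig a')}.
    case: a' => a' a'a /=; split; last first.
      apply: (le_card_sub (f := @proj1_sig _ _)) => // -[x hx] [y hy] _ _ /= e.
      exact: eq_exist.
    exists (fun x : {b | lt b a'} =>
      exist (fun b : {b | lt b a} => lt (proj1_sig b) a')
        (exist _ (proj1_sig x) (tr _ _ _ (proj2_sig x) a'a)) (proj2_sig x)).
    by move=> [x hx] [y hy] [e]; apply: eq_exist.
  apply: (Qcard _ (fun x y => lt (proj1_sig x) (proj1_sig y))).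
    split=> [|a' h]; first exact: segment_wo.
    apply: na; exists (proj1_sig a'); split; first exact: proj2_sig a'.
    exact: le_card_trans h (eqs a').2.
  move=> a'; apply: Qeq (eqs a').1 (eqs a').2 _.
  exact: IH (proj2_sig a').
have [[a h]|na] := pselect (exists a, le_card A {b | lt b a}).
  by apply: Qeq h (Qseg a); apply: le_card_sig.
by apply: Qcard Qseg; split=> // a h; apply: na; exists a.
Qed.

(** * Cardinal arithmetic *)

Lemma nat_not_listed X (f : nat -> X) (l : list X) :
  (forall m n, f m = f n -> m = n) -> ~ (forall n, In (f n) l).
Proof.
move=> fI fl.
have nd : NoDup (List.map f (List.seq 0 (S (length l)))).
  by apply: FinFun.Injective_map_NoDup => //; apply: seq_NoDup.
have := NoDup_incl_length nd (l' := l).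
rewrite length_map length_seq => h.
have : S (length l) <= length l.
  by apply: h => x /in_map_iff[n [<- _]].
lia.
Qed.

Lemma infinite_or_listed A : le_card nat A \/ exists l : list A, forall x, In x l.
Proof.
have [[a]|nA] := pselect (inhabited A); last first.
  by right; exists nil => a; case: nA.
have [[F [_ FR]]|[F [n Fn]]] := greedy (fun _ : A => True) (fun a b => a <> b)
    Wf_nat.lt_wf (inhabits a).
  left; exists F => x y e; apply: contrapT => nxy.
  have [/FR|/FR] : x < y \/ y < x by lia.
    by apply.
  by move=> h; apply: h.
right; exists (List.map F (List.seq 0 n)) => x.
have [m [mn /contrapT <-]] := Fn x I.
by apply: in_map; apply/in_seq; lia.
Qed.

Lemma wf_lex (X A : Type) (f : X -> A) (lt : A -> A -> Prop) (r : X -> X -> Prop) :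
  well_founded lt -> well_founded r ->
  well_founded (fun x y => lt (f x) (f y) \/ f x = f y /\ r x y).
Proof.
move=> wfl wfr x; move: {2}(f x) (erefl (f x)) => a.
elim/(well_founded_ind wfl): a x => a IHa x.
elim/(well_founded_ind wfr): x => x IHx fx.
constructor => y [yx|[e ryx]].
  by apply: (IHa (f y)) => //; rewrite -fx.
by apply: IHx => //; rewrite e.
Qed.

Lemma le_card_prod A B C D :
  le_card A C -> le_card B D -> le_card (A * B) (C * D).
Proof.
move=> [f fI] [g gI]; exists (fun p => (f (fst p), g (snd p))).
by move=> [a b] [a' b'] /= [/fI -> /gI ->].
Qed.

Lemma le_card_closed_segment (A : Type) (lt : A -> A -> Prop) (c : A) :
  (forall a b, lt a b \/ a = b \/ lt b a) ->
  le_card nat {b | lt b c} ->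
  le_card {z | ~ lt c z} ({b | lt b c} * {b | lt b c}).
Proof.
move=> tot [e eI].
(* A second coordinate [e 0] marks the points below [c]; the pair of [e 1] stands for [c] itself. *)
exists (fun z : {z | ~ lt c z} => match pselect (lt (proj1_sig z) c) with
  | left h => (exist _ (proj1_sig z) h, e 0) | right _ => (e 1, e 1) end).
move=> [x hx] [y hy] /=; case: pselect => xp; case: pselect => yp.
- by move=> [exy]; apply: eq_exist.
- by move=> [_ /eI].
- by move=> [_ /eI].
- move=> _; apply: eq_exist.
  have -> : x = c by case: (tot x c) => [//|[]].
  by case: (tot y c) => [//|[]].
Qed.

Lemma le_card_square A : le_card nat A -> le_card (A * A) A.
Proof.
elim/card_ind: A => [A B AB BA IH nB|A lt [[irr [tr [tot wf]]] card] IH nA].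
  apply: le_card_trans (le_card_prod BA BA) _.
  exact: le_card_trans (IH (le_card_trans nB BA)) AB.
(* Goedel's well-ordering of pairs: compare the maxima first *)
pose mx (p : A * A) := if pselect (lt (fst p) (snd p)) then snd p else fst p.
have mx1 p : ~ lt (mx p) (fst p).
  rewrite /mx; case: (pselect (lt (fst p) (snd p))) => [h h'|nh]; last exact: irr.
  exact: irr (tr _ _ _ h h').
have mx2 p : ~ lt (mx p) (snd p).
  by rewrite /mx; case: (pselect (lt (fst p) (snd p))) => [h|nh]; [exact: irr|].
have wf2 := wf_lex (@fst A A) wf (wf_inverse_image _ _ _ (@snd A A) wf).
have tot' (p q : A * A) : (lt (mx p) (mx q) \/ mx p = mx q /\
      (lt (fst p) (fst q) \/ fst p = fst q /\ lt (snd p) (snd q))) \/ p = q \/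
    (lt (mx q) (mx p) \/ mx q = mx p /\
      (lt (fst q) (fst p) \/ fst q = fst p /\ lt (snd q) (snd p))).
  have [m|[m|m]] := tot (mx p) (mx q); try by tauto.
  have [e1|[e1|e1]] := tot (fst p) (fst q); try by intuition.
  have [e2|[e2|e2]] := tot (snd p) (snd q); try by intuition.
  by right; left; case: p q e1 e2 {m} => [a b] [c d] /= -> ->.
(* Otherwise [A] injects into the pairs preceding some [p], hence into the square of the closed
   segment at [mx p], which is finite or, by induction, no larger than the open segment. *)
have [//|[p h]] := le_card_or_segment A (wf_lex mx wf wf2) tot'.
have {}h : le_card A {q : A * A | ~ lt (mx p) (fst q) /\ ~ lt (mx p) (snd q)}.
  apply: le_card_trans h (le_card_sub (f := id) _ _) => // q qp.
  have {}qp : ~ lt (mx p) (mx q).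
    by case: qp => [qp /(tr _ _ _ qp)|[-> _]]; apply: irr.
  split=> hq; apply: qp.
    by case: (tot (mx q) (fst q)) => [/mx1|[->|]] //; apply: tr.
  by case: (tot (mx q) (snd q)) => [/mx2|[->|]] //; apply: tr.
have [inf|[l Hl]] := infinite_or_listed {b | lt b (mx p)}; last first.
  have [f fI] := le_card_trans nA h.
  have [L HL] : exists L, forall z, ~ lt (mx p) z -> In z L.
    exists (mx p :: List.map (@proj1_sig _ _) l) => z nz.
     case: (tot z (mx p)) => [zp|[->|//]]; last by left.
    by right; apply/in_map_iff; exists (exist _ z zp); split=> //; exact: Hl.
  case: (@nat_not_listed _ (fun n => proj1_sig (f n)) (list_prod L L)).
    by move=> m n e; apply: fI; case: (f m) (f n) e => [x hx] [y hy] /= e; apply: eq_exist.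
  by move=> n; case: (f n) => -[a b] [/= ha hb] /=; apply: in_prod; apply: HL.
have sq := IH _ inf.
have hM := le_card_closed_segment tot inf.
case: (card (mx p)); apply: le_card_trans h _; apply: le_card_trans (sq).
have hM' := le_card_trans hM sq.
apply: le_card_trans (le_card_prod hM' hM').
exists (fun q : {q : A * A | ~ lt (mx p) (fst q) /\ ~ lt (mx p) (snd q)} =>
  (exist (fun z => ~ lt (mx p) z) (fst (proj1_sig q)) (proj2_sig q).1,
   exist (fun z => ~ lt (mx p) z) (snd (proj1_sig q)) (proj2_sig q).2)).
by move=> [[a b] hab] [[c d] hcd] /= [ac bd]; apply: eq_exist; rewrite ac bd.
Qed.

Lemma cardinal_no_max (A : Type) (lt : A -> A -> Prop) :
  is_cardinal A lt -> le_card nat A -> forall a, exists b, lt a b.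
Proof.
move=> [[irr [tr [tot wf]]] card] [f fI] a; apply: contrapT => na.
have [inf|[l Hl]] := infinite_or_listed {b | lt b a}.
  apply: (card a); apply: le_card_trans (le_card_square inf).
  apply: le_card_trans (le_card_closed_segment tot inf).
  have h z : ~ lt a z by move=> az; apply: na; exists z.
  by exists (fun z => exist _ z (h z)) => x y [].
case: (@nat_not_listed _ f (a :: List.map (@proj1_sig _ _) l)) => // n.
case: (tot (f n) a) => [h|[->|h]]; [|by left|by case: na; exists (f n)].
by right; apply/in_map_iff; exists (exist (fun b => lt b a) (f n) h).
Qed.

Lemma le_card_decode (A B : Type) : inhabited A -> le_card A B ->
  exists d : B -> A, forall a, exists b, d b = a.
Proof.
move=> iA [f fI].
exists (fun b => epsilon iA (fun a => f a = b)) => a; exists (f a).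
exact: fI (epsilon_spec iA (fun a' => f a' = f a) (ex_intro _ a erefl)).
Qed.

Lemma le_card_of_prod A X Y :
  le_card nat X -> le_card A (X * Y) -> le_card A X \/ le_card A Y.
Proof.
move=> nX h; case: (le_card_total X Y) => XY.
  right; apply: le_card_trans h _.
  apply: le_card_trans (le_card_prod XY (le_card_refl Y)) _.
  exact/le_card_square/le_card_trans/XY.
left; apply: le_card_trans h _.
apply: le_card_trans (le_card_prod (le_card_refl X) XY) _.
exact: le_card_square.
Qed.

Lemma cantor A : ~ le_card (A -> Prop) A.
Proof.
move=> [f fI]; pose D a := exists S : A -> Prop, f S = a /\ ~ S a.
have nD : ~ D (f D) by move=> H; have [S [/fI ->]] := H; apply.
by apply: (nD); exists D.
Qed.

Lemma le_card_pow A B : le_card A B -> le_card (A -> Prop) (B -> Prop).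
Proof.
move=> [f fI]; exists (fun S b => exists a, S a /\ f a = b) => S S' e.
apply: funext => a; apply: propext.
have eb b := congr1 (fun T => T b) e.
split=> Sa.
  by have : exists a', S' a' /\ f a' = f a; [rewrite -eb; exists a|case=> a' [? /fI <-]].
by have : exists a', S a' /\ f a' = f a; [rewrite eb; exists a|case=> a' [? /fI <-]].
Qed.

Lemma le_card_singletons A : le_card A (A -> Prop).
Proof. by exists (fun x y => x = y) => x y e; rewrite (congr1 (fun S => S y) e). Qed.

Lemma beth_mono m n : m <= n -> le_card (beth m) (beth n).
Proof.
elim=> [|k _ IH]; first exact: le_card_refl.
exact: le_card_trans IH (le_card_singletons _).
Qed.

Lemma nat_le_beth n : le_card nat (beth n).
Proof. by apply: (@beth_mono 0); lia. Qed.

Definition sub_beth_omega A := exists n, le_card A (beth n).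

Lemma sub_beth_omega_le A B : le_card A B -> sub_beth_omega B -> sub_beth_omega A.
Proof. by move=> AB [n h]; exists n; apply: le_card_trans AB h. Qed.

Lemma sub_beth_omega_prod A B :
  sub_beth_omega A -> sub_beth_omega B -> sub_beth_omega (A * B).
Proof.
move=> [m hm] [n hn]; exists (Nat.max m n).
apply: le_card_trans (le_card_square (nat_le_beth _)).
apply: le_card_prod.
  by apply: le_card_trans hm _; apply: beth_mono; lia.
by apply: le_card_trans hn _; apply: beth_mono; lia.
Qed.

Lemma sub_beth_omega_pow A : sub_beth_omega A -> sub_beth_omega (A -> Prop).
Proof. by move=> [n h]; exists (S n); apply: le_card_pow. Qed.

Lemma sub_beth_omega_fun A B :
  sub_beth_omega A -> sub_beth_omega B -> sub_beth_omega (A -> B).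
Proof.
move=> hA hB; apply: sub_beth_omega_le (sub_beth_omega_pow (sub_beth_omega_prod hA hB)).
exists (fun f p => f (fst p) = snd p) => f g e.
apply: funext => a; have /= h := congr1 (fun T => T (a, f a)) e.
by have <- : g a = f a by rewrite -h.
Qed.

Lemma sub_beth_omega_beth n : sub_beth_omega (beth n).
Proof. by exists n; apply: le_card_refl. Qed.

Lemma sub_beth_omega_Prop : sub_beth_omega Prop.
Proof.
exists 0; exists (fun P => if pselect P then 0 else 1) => P Q.
by case: pselect => p; case: pselect => q // _; apply: propext.
Qed.

(** * A weak form of the revised GCH *)

(* [S a], for [a : A], is the covering family of at most |A| small sets. *)
Definition coverable (A : Type) (n : nat) :=
  exists S : A -> A -> Prop, (forall a, sub_beth_omega {y | S a y}) /\
  forall k (u : beth k -> A), exists v : beth n -> A,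
  forall x, exists z, S (v z) (u x).

Lemma beth_inhabited n : inhabited (beth n).
Proof. by case: n => [|n]; constructor; [exact: 0|exact: (fun _ => True)]. Qed.

Lemma coverable_equipotent A B n :
  le_card A B -> le_card B A -> coverable A n -> coverable B n.
Proof.
move=> [i iI] [j jI] [S [Ssm Scov]].
exists (fun b y => exists a, b = i a /\ S a (j y)); split=> [b|k u].
  have [[a ea]|na] := pselect (exists a, b = i a); last first.
    exists 0; exists (fun=> 0) => -[y hy]; case: na.
    by case: hy => a [-> _]; exists a.
  apply: sub_beth_omega_le (Ssm a); apply: (le_card_sub (f := j)) => [x|x y _ _ /jI //].
  by move=> [a' [e]]; rewrite (iI a a') // -ea.
have [v hv] := Scov k (fun x => j (u x)).
exists (fun z => i (v z)) => x; have [z hz] := hv x.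
by exists z, (v z).
Qed.

Lemma coverable_sub_beth_omega A :
  inhabited A -> sub_beth_omega A -> exists n, coverable A n.
Proof.
move=> [a0] [n h]; exists 0, (fun _ _ => True); split=> [a|k u].
  by apply: sub_beth_omega_le (le_card_sig _) _; exists n.
by exists (fun=> a0) => x; exists 0.
Qed.

(** Moves a cover of the subtype to [A], so that covers of many segments can share one index type.
    The predicate [b] lets [u] be partial, and any small domain [X] is recoded in some [beth k]. *)
Lemma coverable_on (A : Type) (D : A -> Prop) n :
  inhabited {x | D x} -> coverable {x | D x} n ->
  exists S : A -> A -> Prop, (forall a, sub_beth_omega {y | S a y}) /\
    forall X, sub_beth_omega X -> forall (u : X -> A) (b : X -> Prop),
    (forall x, b x -> D (u x)) ->
    exists v : beth n -> A, (forall z, D (v z)) /\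
      forall x, b x -> exists z, S (v z) (u x).
Proof.
move=> [d0] [S [Ssm Scov]].
exists (fun a y => exists ha hy, S (exist _ a ha) (exist _ y hy)); split.
  move=> a; have [ha|na] := pselect (D a); last first.
    by exists 0; exists (fun=> 0) => -[y hy]; case: na; case: hy.
  apply: sub_beth_omega_le (Ssm (exist _ a ha)).
  have h y : (exists ha hy, S (exist _ a ha) (exist _ y hy)) ->
      exists hy, S (exist _ a ha) (exist _ y hy).
    by move=> [ha' [hy]]; rewrite (Prop_irrelevance ha' ha); exists hy.
  exists (fun y => exist (S (exist _ a ha)) _ (proj2_sig (cid (h _ (proj2_sig y))))).
  by move=> [x hx] [y hy] [/= e]; apply: eq_exist.
move=> X [k [e eI]] u b bD.
have /choice[u' u'E] w : exists d : {x | D x}, forall x, e x = w -> b x -> u x = proj1_sig d.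
  have [[x [ex bx]]|nx] := pselect (exists x, e x = w /\ b x).
    by exists (exist _ _ (bD _ bx)) => y; rewrite -ex => /eI ->.
  by exists d0 => x ex bx; case: nx; exists x.
have [v hv] := Scov k u'.
exists (fun z => proj1_sig (v z)); split=> [z|x bx]; first exact: proj2_sig.
have [z hz] := hv (e x); exists z, (proj2_sig (v z)).
have ux := u'E _ x erefl bx.
have hD : D (u x) by rewrite ux; apply: proj2_sig.
exists hD.
have -> : exist D (proj1_sig (v z)) (proj2_sig (v z)) = v z by case: (v z).
suff -> : exist D (u x) hD = u' (e x) by [].
by case: (u' (e x)) ux => y hy /= ?; apply: eq_exist.
Qed.

Definition bounded_coverable (A : Type) (lt : A -> A -> Prop) n :=
  exists S : A -> A -> Prop, (forall a, sub_beth_omega {y | S a y}) /\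
  forall k (u : beth k -> A) (b : beth k -> Prop) a,
    (forall x, b x -> lt (u x) a) ->
    exists v : beth n -> A, forall x, b x -> exists z, S (v z) (u x).

(** If some [beth N] is cofinal in [A], a family splits into [beth N] bounded pieces, each covered
    by [beth n] sets. Otherwise every small family is bounded already. *)
Lemma bounded_coverable_coverable (A : Type) (lt : A -> A -> Prop) n :
  (forall a b, lt a b \/ a = b \/ lt b a) ->
  (forall a b c, lt a b -> lt b c -> lt a c) ->
  (forall a, exists b, lt a b) ->
  bounded_coverable lt n -> exists n', coverable A n'.
Proof.
move=> tot tr nomax [S [Ssm Sb]].
have [[N [c cof]]|ncof] :=
    pselect (exists N (c : beth N -> A), forall a, exists z, lt a (c z)).
  have [n' hn'] := sub_beth_omega_prod (sub_beth_omega_beth N) (sub_beth_omega_beth n).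
  have iP : inhabited (beth N * beth n).
    by case: (beth_inhabited N) => x; case: (beth_inhabited n) => y; constructor.
  have [d dE] := le_card_decode iP hn'.
  exists n', S; split=> // k u.
  have /choice[v hv] z := Sb k u (fun x => lt (u x) (c z)) (c z) (fun x h => h).
  exists (fun w => v (fst (d w)) (snd (d w))) => x.
  have [z uz] := cof (u x).
  have [y hy] := hv z x uz.
  have [w dw] := dE (z, y).
  by exists w; rewrite dw.
exists n, S; split=> // k u.
have [a ha] : exists a, forall x, lt (u x) a.
  apply: contrapT => na; apply: ncof; exists k, u => a; apply: contrapT => nz.
  have [b ab] := nomax a; apply: na; exists b => x.
  case: (tot (u x) a) => [h|[->//|h]]; first exact: tr h ab.
  by case: nz; exists x.
have [v hv] := Sb k u (fun=> True) a (fun x _ => ha x).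
by exists v => x; apply: hv.
Qed.

(** * Sigma-ideals and functions that differ modulo an ideal *)

Definition sigma_ideal (T : Type) (J : (T -> Prop) -> Prop) :=
  [/\ J (fun _ => False),
      forall s t : T -> Prop, (forall i, s i -> t i) -> J t -> J s &
      forall s : nat -> T -> Prop, (forall n, J (s n)) -> J (fun i => exists n, s n i)].

Lemma sigma_ideal_union2 T (J : (T -> Prop) -> Prop) s t :
  sigma_ideal J -> J s -> J t -> J (fun i => s i \/ t i).
Proof.
move=> [J0 Jsub Ju] Js Jt.
apply: (Jsub _ (fun i => exists n : nat, (if n is 0 then s else t) i)).
  by move=> i [si|ti]; [exists 0|exists 1].
by apply: Ju; case.
Qed.

Definition restr T (J : (T -> Prop) -> Prop) (b : T -> Prop) : (T -> Prop) -> Prop :=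
  fun s => J (fun i => b i /\ s i).

Lemma restr_sigma_ideal T (J : (T -> Prop) -> Prop) b :
  sigma_ideal J -> sigma_ideal (restr J b).
Proof.
move=> [J0 Jsub Ju]; split.
- by apply: Jsub J0 => i [].
- by move=> s t st; apply: Jsub => i [bi /st].
- move=> s Js; apply: Jsub (Ju _ Js) => i [bi [n si]]; by exists n.
Qed.

Definition different_below (A T : Type) (lt : A -> A -> Prop)
    (J : (T -> Prop) -> Prop) (h : T -> A) (F : A -> T -> A) :=
  (forall a, J (fun i => ~ lt (F a i) (h i))) /\
  (forall a b, a <> b -> J (fun i => F a i = F b i)).

Definition catches_below (A T : Type) (lt : A -> A -> Prop)
    (J : (T -> Prop) -> Prop) (h : T -> A) (L : A -> T -> A) :=
  forall g : T -> A, J (fun i => ~ lt (g i) (h i)) ->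
  exists a, ~ J (fun i => g i = L a i).

Lemma different_or_catches (A T : Type) (lt : A -> A -> Prop)
    (J : (T -> Prop) -> Prop) (h : T -> A) :
  strict_well_order A lt -> inhabited A -> sigma_ideal J ->
  (exists F, different_below lt J h F) \/ (exists L, catches_below lt J h L).
Proof.
move=> [_ [_ [tot wf]]] [a0] [_ Jsub _].
have [[F [FQ FR]]|[F [x Fx]]] := greedy (fun g => J (fun i => ~ lt (g i) (h i)))
    (fun f g => J (fun i => f i = g i)) wf (inhabits (fun _ : T => a0)).
  left; exists F; split=> // a b nab; case: (tot a b) => [ab|[//|ba]].
    exact: FR.
  by apply: Jsub (FR _ _ ba).
right; exists F => g /Fx[y [_ nJ]]; exists y => Jg; apply: nJ; by apply: Jsub Jg.
Qed.

(** With one [n] good for cofinally many segments, all their covers are merged into one, indexed by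
    pairs (segment, index), which [A] can code. *)
Lemma bounded_coverable_cofinal (A : Type) (lt : A -> A -> Prop) n :
  le_card (A * A) A -> inhabited A ->
  (forall a b c, lt a b -> lt b c -> lt a c) ->
  (forall a, exists a', lt a a' /\ coverable {b | lt b a'} n) ->
  bounded_coverable lt n.
Proof.
move=> sq [a0] tr cof.
have [d dE] := le_card_decode (inhabits (a0, a0)) sq.
have /choice[S SE] a : exists S : A -> A -> Prop, (forall a, sub_beth_omega {y | S a y}) /\
    (inhabited {b | lt b a} -> coverable {b | lt b a} n ->
    forall X, sub_beth_omega X -> forall (u : X -> A) (b : X -> Prop),
    (forall x, b x -> lt (u x) a) ->
    exists v : beth n -> A, forall x, b x -> exists z, S (v z) (u x)).
  have [[i c]|nic] := pselect (inhabited {b | lt b a} /\ coverable {b | lt b a} n).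
    have [S [Ssm SE]] := coverable_on i c; exists S; split=> // _ _ X hX u b ub.
    by have [v [_ hv]] := SE X hX u b ub; exists v.
  exists (fun _ _ => False); split=> [_|i c]; last by case: nic.
  by exists 0; exists (fun=> 0) => -[].
exists (fun w => S (fst (d w)) (snd (d w))); split=> [w|k u b a ub].
  exact: (SE _).1.
have [a' [aa' c]] := cof a.
have [|v hv] := (SE a').2 (inhabits (exist _ a aa')) c _ (sub_beth_omega_beth k) u b.
  by move=> x /ub h; apply: tr h aa'.
have /choice[w hw] z := dE (a', v z).
by exists w => x /hv[z hz]; exists z; rewrite hw.
Qed.

Lemma bounded_coverable_no_different (A : Type) (lt : A -> A -> Prop) :
  strict_well_order A lt -> le_card nat A -> (forall m, le_card (beth m) A) ->
  (forall a m (J : (beth m -> Prop) -> Prop), sigma_ideal J -> ~ J (fun _ => True) ->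
    ~ exists F, different_below lt J (fun _ => a) F) ->
  bounded_coverable lt 0.
Proof.
move=> wo nA big nd; have [f0 _] := nA.
have sq := le_card_square nA.
(* By computation [beth (S (S m))] is the type of families of subsets of [beth m], so an element of
   [Z] names an ideal, a bound and the index of a catching function. *)
pose Z := ({m : nat & beth (S (S m))} * (A * A))%type.
have hZ : le_card Z A.
  apply: le_card_trans (sq).
  apply: le_card_prod => //.
  apply: le_card_trans (sq).
  apply: le_card_trans (le_card_prod nA (le_card_refl A)).
  exists (fun p : {m : nat & beth (S (S m))} =>
    (projT1 p, proj1_sig (cid (big (S (S (projT1 p))))) (projT2 p))).
  move=> [m x] [m' y] /= [e]; subst m'.
  by case: cid => f /= fI /fI ->.
have iZ : inhabited Z by constructor; exact: (existT _ 0 (fun _ => True), (f0 0, f0 0)).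
have [d dE] := le_card_decode iZ hZ.
pose L m (J : beth (S (S m))) a : A -> beth m -> A :=
  epsilon (inhabits (fun _ _ => a)) (catches_below lt J (fun _ => a)).
pose S (z : Z) y := exists i, L _ (projT2 (fst z)) (fst (snd z)) (snd (snd z)) i = y.
exists (fun w => S (d w)); split=> [w|k u b a ub].
  exists (projT1 (fst (d w))); rewrite /S.
  exact: le_card_range.
(* The sets on which [u] is covered by countably many ranges. Were this ideal proper, some catching
   function would agree with [u] on a positive set; yet its range alone covers [u] there. *)
pose I (s : beth k -> Prop) :=
  exists v : nat -> A, forall x, s x -> b x -> exists j, S (d (v j)) (u x).
have sI : sigma_ideal I.
  split.
  - by exists f0.
  - by move=> s t st [v hv]; exists v => x /st; apply: hv.
  - move=> s /choice[v hv].
    have [c cE] := le_card_decode (inhabits (0, 0)) (le_card_square (le_card_refl nat)).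
    exists (fun j => v (fst (c j)) (snd (c j))) => x [n sx] bx.
    have [j hj] := hv n x sx bx; have [i ci] := cE (n, j).
    by exists i; rewrite ci.
have [[v hv]|nI] := pselect (I (fun _ => True)).
  by exists v => x; apply: hv.
have [//|cL] := different_or_catches (fun _ : beth k => a) wo (inhabits a) sI.
  by move/nd; case.
have [|eta nI'] := epsilon_spec (inhabits (fun _ _ => a)) _ cL u.
  by exists f0 => x nux /ub.
case: nI'; have [w hw] := dE (existT _ k I, (a, eta)).
by exists (fun=> w) => x ux bx; exists 0; rewrite hw; exists x.
Qed.

(** Countably many exceptional sets do not fill [T], so a descending sequence modulo [J] would
    descend everywhere at some single point. *)
Lemma wf_modulo_ideal (A T : Type) (lt : A -> A -> Prop) (J : (T -> Prop) -> Prop) :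
  well_founded lt -> sigma_ideal J -> ~ J (fun _ => True) ->
  well_founded (fun g h : T -> A => J (fun i => ~ lt (g i) (h i))).
Proof.
move=> wf [_ Jsub Ju] nJ h; apply: contrapT => nh.
set R := fun g h : T -> A => _ in nh.
have /choice[next nextP] (g : {g | ~ Acc R g}) :
    exists g' : {g | ~ Acc R g}, R (proj1_sig g') (proj1_sig g).
  case: g => g ng /=; apply: contrapT => nex; apply: ng; constructor => g' g'g.
  by apply: contrapT => ng'; apply: nex; exists (exist _ g' ng').
pose f n := Nat.iter n next (exist _ h nh).
have fP n : R (proj1_sig (f (S n))) (proj1_sig (f n)) by apply: nextP.
have [i fi] : exists i, forall n, lt (proj1_sig (f (S n)) i) (proj1_sig (f n) i).
  apply: contrapT => ni; apply: nJ; apply: Jsub (Ju _ fP) => i _.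
  by apply: contrapT => h'; apply: ni; exists i => n;
     apply: contrapT => h''; apply: h'; exists n.
move: {2}(proj1_sig (f 0) i) (erefl (proj1_sig (f 0) i)); move: 0 => n a.
elim/(well_founded_ind wf): a n => a IH n e.
by apply: IH (erefl (proj1_sig (f (S n)) i)); rewrite -e.
Qed.

Lemma different_below_sub (A T : Type) (lt : A -> A -> Prop)
    (J J' : (T -> Prop) -> Prop) (h h' : T -> A) F :
  (forall s, J s -> J' s) ->
  (forall a, J (fun i => ~ lt (F a i) (h i)) -> J' (fun i => ~ lt (F a i) (h' i))) ->
  different_below lt J h F -> different_below lt J' h' F.
Proof. by move=> JJ hh [F1 F2]; split=> [a|a b /F2 /JJ //]; apply/hh/F1. Qed.

(* [Y] is the sigma-ideal generated by the sets on which some [g] below [h]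
still bounds A many different functions; minimality of [h], among the
bounds that are good on a countable cover, makes it proper. *)
Lemma minimal_bound (A T : Type) (lt : A -> A -> Prop) (J0 : (T -> Prop) -> Prop)
    (h0 : T -> A) F0 (p : A -> nat) :
  well_founded lt -> sigma_ideal J0 -> ~ J0 (fun _ => True) ->
  different_below lt J0 h0 F0 ->
  exists (J Y : (T -> Prop) -> Prop) (h : T -> A) (F : A -> T -> A),
    [/\ sigma_ideal J, sigma_ideal Y, forall s, J s -> Y s & ~ Y (fun _ => True)] /\
    [/\ different_below lt J h F, exists n, J (fun i => p (h i) <> n) &
      forall c g, ~ Y c -> J (fun i => c i /\ ~ lt (g i) (h i)) ->
        ~ exists F', different_below lt (restr J c) g F'].
Proof.
move=> wf sJ nJ dF0; have [J00 J0sub J0u] := sJ.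
pose good h := exists b : nat -> T -> Prop, (forall i, exists n, b n i) /\
  forall n, exists F, different_below lt (restr J0 (b n)) h F.
have [|h [[b [bT bF]] hmin]] := @wf_min _ _ good (wf_modulo_ideal wf sJ nJ).
  exists h0, (fun _ _ => True); split=> [i|_]; first by exists 0.
  exists F0; apply: different_below_sub dF0 => [s|a]; apply: J0sub => i; tauto.
pose Z c := exists g, J0 (fun i => c i /\ ~ lt (g i) (h i)) /\
  exists F, different_below lt (restr J0 c) g F.
pose Y s := exists c : nat -> T -> Prop, (forall i, s i -> exists n, c n i) /\
  forall n, Z (c n).
have ZJ s : J0 s -> Z s.
  move=> Js; exists h; split; first by apply: J0sub Js => i [].
  by exists F0; split=> [a|a a' _]; apply: J0sub Js => i [].
have YJ s : J0 s -> Y s.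
  by move=> Js; exists (fun=> s); split=> [i si|_]; [exists 0|apply: ZJ].
have sY : sigma_ideal Y.
  split; first exact: YJ.
    by move=> s t st [c [tc cZ]]; exists c; split=> // i /st /tc.
  move=> s /choice[c cP].
  have [d dE] := le_card_decode (inhabits (0, 0)) (le_card_square (le_card_refl nat)).
  exists (fun j => c (fst (d j)) (snd (d j))); split=> [i [n sni]|j]; last exact: (cP _).2.
  have [m cm] := (cP n).1 i sni; have [j dj] := dE (n, m).
  by exists j; rewrite dj.
(* If countably many sets of [Z] covered [T], their bounds glued along the cover would form a good
   bound below [h]. *)
have nY : ~ Y (fun _ => True).
  move=> [c [cT /choice[g gP]]].
  have /choice[mu muP] i := cT i I.
  apply: (hmin (fun i => g (mu i) i)).
    exists (fun n i => mu i = n); split=> [i|n]; first by exists (mu i).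
    have [F dF] := (gP n).2; exists F.
    apply: different_below_sub dF => [s|a]; apply: J0sub => i [e hi]; subst n; split=> //.
  apply: J0sub (J0u _ (fun n => (gP n).1)) => i hi; exists (mu i).
  by split.
(* Restricting to a [Y]-positive cell on which [p (h i)] is constant will give one covering index
   for almost all segments below [h i]. *)
have [n [k nYb]] : exists n k, ~ Y (fun i => b n i /\ p (h i) = k).
  apply: contrapT => all; apply: nY.
  have [_ Ysub Yu] := sY.
  apply: (Ysub _ (fun i => exists n k, b n i /\ p (h i) = k)).
    by move=> i _; have [n bni] := bT i; exists n, (p (h i)).
  apply: (Yu) => n; apply: (Yu) => k; apply: contrapT => nYb; apply: all.
  by exists n, k.
set c := fun i => _ in nYb.
have [F dF] := bF n.
exists (restr J0 c), (restr Y c), h, F; split; split.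
- exact: restr_sigma_ideal.
- exact: restr_sigma_ideal.
- by move=> s; apply: YJ.
- by move=> Yc; apply: nYb; case: sY => _ Ysub _; apply: Ysub Yc.
- by apply: different_below_sub dF => [s|a]; apply: J0sub => i [[bi _] hi].
- by exists k; apply: J0sub J00 => i [[_ e]].
- move=> t g nYt Jg [F' dF']; apply: nYt.
  exists (fun=> (fun i => c i /\ t i)); split=> [i hi|_]; first by exists 0.
  exists g; split; first by apply: J0sub Jg => i; tauto.
  by exists F'; apply: different_below_sub dF' => [s|a]; apply: J0sub => i; tauto.
Qed.

Lemma le_card_fibers (A S B : Type) (f : A -> S) :
  (forall s, le_card {x | f x = s} B) -> le_card A (S * B).
Proof.
move=> fib.
have [[a]|nA] := pselect (inhabited A); last first.
  by exists (fun a => False_rect _ (nA (inhabits a))) => a; case: nA.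
have iB : inhabited B by have [g _] := fib (f a); constructor; exact: (g (exist _ a erefl)).
have /choice[g gI] s := le_card_inj_on iB (fib s).
exists (fun x => (f x, g (f x) x)) => x y [e]; rewrite e => /gI; exact.
Qed.

(** Suppose each set [B a], where [F a] is not below [g], is in [Y]. There are at most [beth (S m)]
    such sets, so for each [k] one of them, [s k], comes from more [a] than lie below [alpha k]. The
    countably many [s k] together come from |A| many [a], and off their union these [F a] lie below
    [g], against [hmin]. *)
Lemma unbounded_value (A : Type) (lt : A -> A -> Prop) (alpha : nat -> A) m
    (J Y : (beth m -> Prop) -> Prop) (h : beth m -> A) (F : A -> beth m -> A) :
  is_cardinal A lt -> ~ sub_beth_omega A ->
  (forall a, exists n, lt a (alpha n)) ->
  sigma_ideal J -> sigma_ideal Y -> (forall s, J s -> Y s) -> ~ Y (fun _ => True) ->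
  different_below lt J h F ->
  (forall c g, ~ Y c -> J (fun i => c i /\ ~ lt (g i) (h i)) ->
    ~ exists F', different_below lt (restr J c) g F') ->
  forall g, J (fun i => ~ lt (g i) (h i)) ->
  exists a, ~ Y (fun i => ~ lt (F a i) (g i)).
Proof.
move=> [[irr [tr [tot wf]]] card] big cof sJ sY JY nY [F1 F2] hmin g Jg.
apply: contrapT => all.
pose B a := fun i => ~ lt (F a i) (g i).
have YB a : Y (B a) by apply: contrapT => nYB; apply: all; exists a.
have /choice[s sP] k : exists s, ~ le_card {a | B a = s} {b | lt b (alpha k)}.
  apply: contrapT => /forallNP h'.
  have h2 s : le_card {a | B a = s} {b | lt b (alpha k)} by apply: contrapT; apply: h'.
  case: (le_card_of_prod (nat_le_beth (S m)) (le_card_fibers h2)) => [hA|hA].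
    by apply: big; exists (S m).
  exact: card hA.
have Ys k : Y (s k).
  apply: contrapT => nYs; apply: (sP k).
  have nh : forall a, B a = s k -> False by move=> a e; apply: nYs; rewrite -e.
  exists (fun x => False_rect _ (nh _ (proj2_sig x))) => -[a ea]; case: (nh a ea).
have [[e eI]|[x hx]] := le_card_or_segment {a | exists k, B a = s k} wf tot; last first.
  have [k xk] := cof x; apply: (sP k).
  apply: le_card_trans (le_card_trans (le_card_sub (f := id) _ _) hx)
    (le_card_sub (f := id) _ _) => //.
    by move=> a ea; exists k.
  by move=> y yx; apply: tr yx xk.
pose c i := ~ exists k, s k i.
have [_ Ysub Yu] := sY; have [J0 Jsub _] := sJ.
have nYc : ~ Y c.
  move=> Yc; apply: nY; apply: Ysub (sigma_ideal_union2 sY Yc (Yu _ Ys)) => i _.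
  by have [h'|h'] := pselect (exists k, s k i); [right|left].
apply: (hmin c g nYc); first by apply: Jsub Jg => i [].
exists (fun a => F (proj1_sig (e a))); split=> [a|a a' naa'].
  apply: Jsub J0 => i [ci hi]; apply: ci; have [k ek] := proj2_sig (e a).
  by exists k; rewrite -ek.
apply: Jsub (F2 (proj1_sig (e a)) (proj1_sig (e a')) _) => [i []//|].
move=> e'; apply/naa'/eI; case: (e a) (e a') e' => y hy [y' hy'] /= ?; exact: eq_exist.
Qed.

(** Given [g], take [F a] not below [g] on a [Y]-positive set. Either [F a] itself catches [g], or
    [g] is below [F a] on a [Y]-positive set [c]; there [hmin] excludes the first case of the
    dichotomy, so functions depending only on [a] and [c] catch [g]. *)
Lemma catches_minimal_bound (A : Type) (lt : A -> A -> Prop) m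
    (J Y : (beth m -> Prop) -> Prop) (h : beth m -> A) (F : A -> beth m -> A) :
  strict_well_order A lt -> le_card nat A -> (forall m, le_card (beth m) A) ->
  sigma_ideal J -> sigma_ideal Y -> (forall s, J s -> Y s) ->
  different_below lt J h F ->
  (forall c g, ~ Y c -> J (fun i => c i /\ ~ lt (g i) (h i)) ->
    ~ exists F', different_below lt (restr J c) g F') ->
  (forall g, J (fun i => ~ lt (g i) (h i)) ->
    exists a, ~ Y (fun i => ~ lt (F a i) (g i))) ->
  exists L, catches_below lt J h L.
Proof.
move=> wo nA big sJ sY JY [F1 F2] hmin hub; have [f0 _] := nA.
have [_ [_ [tot _]]] := wo.
have sq := le_card_square nA.
pose Z := (nat * (A * ((beth m -> Prop) * A)))%type.
have hZ : le_card Z A.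
  apply: le_card_trans (sq); apply: le_card_prod => //.
  apply: le_card_trans (sq); apply: le_card_prod; first exact: le_card_refl.
  apply: le_card_trans (sq); apply: le_card_prod; last exact: le_card_refl.
  exact: (big (S m)).
have [d dE] := le_card_decode (inhabits ((0, (f0 0, (fun=> True, f0 0))) : Z)) hZ.
pose M a c := epsilon (inhabits F) (catches_below lt (restr J c) (F a)).
(* Tag 0 lists the [F a], a nonzero tag the catching functions attached to [a] and [c]. *)
exists (fun w => if fst (d w) is 0 then F (fst (snd (d w)))
  else M (fst (snd (d w))) (fst (snd (snd (d w)))) (snd (snd (snd (d w))))) => g Jg.
have [a nYa] := hub g Jg.
have [Ja|nJa] := pselect (J (fun i => g i = F a i)); last first.
  by have [w hw] := dE (0, (a, (fun=> True, f0 0))); exists w; rewrite hw.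
pose c i := lt (g i) (F a i).
have [_ Jsub _] := sJ; have [J0 _ _] := sJ; have [_ Ysub _] := sY.
have nYc : ~ Y c.
  move=> Yc; apply: nYa; apply: Ysub (sigma_ideal_union2 sY Yc (JY _ Ja)) => i nlt.
  by case: (tot (g i) (F a i)) => [|[|]]; [left|right|].
have [nd|cL] := different_or_catches (F a) wo (inhabits a) (restr_sigma_ideal c sJ).
  by case: (hmin c (F a) nYc _ nd); apply: Jsub (F1 a) => i [].
have [|b nJb] := epsilon_spec (inhabits F) _ cL g.
  by apply: Jsub J0 => i [].
have [w hw] := dE (1, (a, (c, b))); exists w; rewrite hw /= => J'.
by apply: nJb; apply: Jsub J' => i [].
Qed.

Lemma coverable_minimal_bound (A : Type) (lt : A -> A -> Prop) m n
    (J : (beth m -> Prop) -> Prop) (h : beth m -> A) (F L : A -> beth m -> A) :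
  le_card nat A -> sigma_ideal J -> ~ J (fun _ => True) ->
  different_below lt J h F -> catches_below lt J h L ->
  J (fun i => ~ (inhabited {b | lt b (h i)} -> coverable {b | lt b (h i)} n)) ->
  exists n', coverable A n'.
Proof.
move=> nA sJ nJ [F1 F2] Lc Jn; have [J0 Jsub Ju] := sJ; have [f0 _] := nA.
pose good i := inhabited {b | lt b (h i)} /\ coverable {b | lt b (h i)} n.
have Jgood : J (fun i => ~ good i).
  apply: Jsub (sigma_ideal_union2 sJ Jn (F1 (f0 0))) => i ng.
  have [l|nl] := pselect (lt (F (f0 0) i) (h i)); [left|by right].
  move=> hi; apply: ng; split; first by constructor; exists (F (f0 0) i).
  by apply: hi; constructor; exists (F (f0 0) i).
have /choice[S SE] i : exists S : A -> A -> Prop, (forall a, sub_beth_omega {y | S a y}) /\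
    (good i -> forall X, sub_beth_omega X -> forall (u : X -> A) (b : X -> Prop),
    (forall x, b x -> lt (u x) (h i)) ->
    exists v : beth n -> A, (forall z, lt (v z) (h i)) /\
      forall x, b x -> exists z, S (v z) (u x)).
  have [[g1 g2]|ng] := pselect (good i).
    by have [S [S1 S2]] := coverable_on g1 g2; exists S.
  exists (fun _ _ => False); split=> [_|//].
  by exists 0; exists (fun=> 0) => -[].
have /choice[mm mmE] a : exists mm : beth m -> nat,
    forall i, le_card {y | S i (L a i) y} (beth (mm i)).
  by have [mm mmE] := choice (fun i => (SE i).1 (L a i)); exists mm.
have [d dE] := le_card_decode (inhabits (0, f0 0))
  (le_card_trans (le_card_prod nA (le_card_refl A)) (le_card_square nA)).
(* The covering set of [w] consists of the [x] for which [F x i] lies in the small set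
   [S i (L (snd w) i)], of size at most [beth (fst w)], for positively many [i]. *)
pose s (w : nat * A) x i := mm (snd w) i = fst w /\ S i (L (snd w) i) (F x i).
have [n' hn'] := sub_beth_omega_prod
  (sub_beth_omega_fun (sub_beth_omega_beth m) (sub_beth_omega_beth n))
  (sub_beth_omega_beth 0).
exists n', (fun w x => ~ J (s (d w) x)); split=> [w|k u].
  move: (d w) => {w} [k a].
  have /choice[c cE] i : exists c : A -> beth k, mm a i = k ->
      forall y y', S i (L a i) y -> S i (L a i) y' -> c y = c y' -> y = y'.
    have [e|ne] := pselect (mm a i = k).
      by have := mmE a i; rewrite e => /(le_card_inj_on (beth_inhabited k))[c]; exists c.
    by have [z] := beth_inhabited k; exists (fun=> z).
  apply: sub_beth_omega_le (sub_beth_omega_fun (sub_beth_omega_beth m)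
    (sub_beth_omega_prod sub_beth_omega_Prop (sub_beth_omega_beth k))).
  (* This code determines [x]: equal codes make [F x] and [F y] agree on a positive set. *)
  exists (fun x i => (s (k, a) (proj1_sig x) i, c i (F (proj1_sig x) i))).
  move=> [x hx] [y hy] /= e; apply: eq_exist; apply: contrapT => nxy.
  apply: hx; apply: Jsub (F2 _ _ nxy) => i sx.
  have [es ec] : s (k, a) x i = s (k, a) y i /\ c i (F x i) = c i (F y i).
    by have := congr1 (fun f => f i) e => -[].
  have sy : s (k, a) y i by rewrite -es.
  by apply: cE ec; [case: sx|case: sx|case: sy].
have /choice[v vE] i : exists v : beth n -> A, good i -> (forall z, lt (v z) (h i)) /\
    forall x, lt (F (u x) i) (h i) -> exists z, S i (v z) (F (u x) i).
  have [g|ng] := pselect (good i); last by exists (fun=> f0 0).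
  have [v hv] := (SE i).2 g _ (sub_beth_omega_beth k) (fun x => F (u x) i)
    (fun x => lt (F (u x) i) (h i)) (fun x l => l).
  by exists v.
(* Each choice [e] of one covering index per coordinate gives a function below [h], which some
   [L (eta e)] catches. The [beth m -> beth n] choices thus index the cover of [u]. *)
have /choice[eta etaE] (e : beth m -> beth n) : exists a, ~ J (fun i => v i (e i) = L a i).
  apply: Lc; apply: Jsub Jgood => i nl g; apply: nl; exact: (vE i g).1.
have [z0] := beth_inhabited n.
have [d' d'E] := le_card_decode (inhabits (fun=> z0, 0)) hn'.
have /choice[code codeE] w := dE (snd (d' w), eta (fst (d' w))).
exists code => x.
have /choice[e eE] i : exists z, good i -> lt (F (u x) i) (h i) -> S i (v i z) (F (u x) i).
  have [[g l]|ngl] := pselect (good i /\ lt (F (u x) i) (h i)).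
    by have [z hz] := (vE i g).2 x l; exists z.
  by exists z0 => g l; case: ngl.
have [k' hk'] : exists k', ~ J (s (k', eta e) (u x)).
  apply: contrapT => all; apply: (etaE e).
  apply: Jsub (sigma_ideal_union2 sJ (sigma_ideal_union2 sJ Jgood (F1 (u x)))
    (Ju (fun k' => s (k', eta e) (u x)) _)) => [i ei|k']; last first.
    by apply: contrapT => nJs; apply: all; exists k'.
  have [g|ng] := pselect (good i); last by left; left.
  have [l|nl] := pselect (lt (F (u x) i) (h i)); last by left; right.
  right; exists (mm (eta e) i); split=> //=; rewrite -ei; exact: eE.
have [w hw] := d'E (e, k').
by exists w; rewrite codeE hw.
Qed.

Lemma coverable_all (A : Type) : inhabited A -> exists n, coverable A n.
Proof.
elim/card_ind: A => [A B AB BA IH [b]|A lt cA IH iA].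
  have [|n c] := IH; first by case: BA => f _; constructor; exact: (f b).
  by exists n; apply: coverable_equipotent AB BA c.
have [small|big] := pselect (sub_beth_omega A); first exact: coverable_sub_beth_omega.
have big' m : le_card (beth m) A.
  by case: (le_card_total (beth m) A) => // h; case: big; exists m.
have nA : le_card nat A := big' 0.
have nomax := cardinal_no_max cA nA.
have [wo card] := cA; have [irr [tr [tot wf]]] := wo.
have sq := le_card_square nA.
have /choice[p pE] a : exists n, inhabited {b | lt b a} -> coverable {b | lt b a} n.
  have [i|ni] := pselect (inhabited {b | lt b a}); last by exists 0.
  by have [n c] := IH a i; exists n.
have [[n cof]|ncof] := pselect (exists n,
    forall a, exists a', lt a a' /\ coverable {b | lt b a'} n).
  apply: (bounded_coverable_coverable tot tr nomax).
  exact: bounded_coverable_cofinal sq iA tr cof.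
have /choice[alpha alphaE] n : exists a, forall a', lt a a' -> ~ coverable {b | lt b a'} n.
  apply: contrapT => h; apply: ncof; exists n => a; apply: contrapT => h'; apply: h.
  by exists a => a' aa' c; apply: h'; exists a'.
(* For [b] above [a] the segment below [b] is coverable with [p b], so [b] cannot lie beyond
   [alpha (p b)]. *)
have alpha_cof a : exists n, lt a (alpha n).
  have [b ab] := nomax a; exists (p b).
  case: (tot (alpha (p b)) b) => [h|[->//|h]]; last exact: tr ab h.
  case: (alphaE _ _ h); apply: pE; constructor; by exists a.
have [nd|] := pselect (forall a m (J : (beth m -> Prop) -> Prop), sigma_ideal J ->
    ~ J (fun _ => True) -> ~ exists F, different_below lt J (fun _ => a) F).
  apply: (bounded_coverable_coverable tot tr nomax).
  exact: bounded_coverable_no_different wo nA big' nd.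
move/existsNP=> [a /existsNP[m /existsNP[J0]]].
move/not_implyP=> [sJ0 /not_implyP[nJ0 /contrapT[F0 dF0]]].
have [J [Y [h [F [[sJ sY JY nY] [dF [n Jn] hmin]]]]]] := minimal_bound p wf sJ0 nJ0 dF0.
have hub := unbounded_value cA big alpha_cof sJ sY JY nY dF hmin.
have [L cL] := catches_minimal_bound wo nA big' sJ sY JY dF hmin hub.
apply: (coverable_minimal_bound (n := n) nA sJ _ dF cL); first by move/JY.
case: sJ => _ Jsub _; apply: Jsub Jn => i nc e; apply: nc; rewrite -e; exact: pE.
Qed.

(** * Dominating and unreaped families *)

Lemma no_infinite_decreasing (X K : Type) (prec : X -> X -> Prop)
    (lt : K -> K -> Prop) (D : X -> Prop) (phi : X -> K) :
  strict_well_order X prec -> well_founded lt ->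
  (forall x y, D x -> D y -> prec x y -> lt (phi y) (phi x)) ->
  ~ le_card nat {x | D x}.
Proof.
move=> [irr [tr [tot wf]]] wfK dec [f fI].
have key x : D x -> exists l, forall y, D y -> ~ prec y x -> In y l.
  move: {2}(phi x) (erefl (phi x)) => d.
  elim/(well_founded_ind wfK): d x => d IH x ex Dx.
  have [above|none] := pselect (exists y, D y /\ prec x y); last first.
    exists (x :: nil) => y Dy nyx; left.
    by case: (tot x y) => [xy|[|]] //; case: none; exists y.
  have [y [[Dy xy] ymin]] := wf_min wf above.
  have [|l lP] := IH (phi y) _ y erefl Dy; first by rewrite -ex; apply: dec.
  exists (x :: l) => z Dz nzx.
  case: (tot x z) => [xz|[->|//]]; [right|by left].
  by apply: lP => //; apply: ymin.
have [x [Dx xmin]] := wf_min wf (ex_intro D _ (proj2_sig (f 0))).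
have [l lP] := key x Dx.
apply: (@nat_not_listed _ (fun n => proj1_sig (f n)) l) => [i j e|i].
  by apply: fI; apply: eq_sig_hprop e => ? ? ?; apply: Prop_irrelevance.
by apply: lP; [|apply: xmin]; apply: proj2_sig.
Qed.

Definition unbounded (K : Type) (lt : K -> K -> Prop) (P : K -> Prop) :=
  forall a, exists b, P b /\ lt a b.

Lemma bounded_family (K : Type) (lt : K -> K -> Prop) X (u : X -> K) :
  is_regular_cardinal K lt -> ~ le_card K X -> exists s, forall x, lt (u x) s.
Proof.
move=> [_ reg] nX; apply: contrapT => ns; apply: nX.
apply: le_card_trans (reg (fun y => exists x, u x = y) _) (le_card_range u) => a.
apply: contrapT => na; apply: ns; exists a => x; apply: contrapT => nl.
by apply: na; exists (u x); split=> //; exists x.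
Qed.

Lemma initial_segment_small (K : Type) (lt : K -> K -> Prop) a :
  is_cardinal K lt -> le_card nat K -> ~ le_card K {b | ~ lt a b}.
Proof.
move=> cK nK h; have [c ac] := cardinal_no_max cK nK a.
have [[irr [tr [tot wf]]] card] := cK.
apply: (card c); apply: le_card_trans h (le_card_sub (f := id) _ _) => // b nab.
by case: (tot a b) => [//|[<-//|ba]]; apply: tr ba ac.
Qed.

Lemma full_size_unbounded (K : Type) (lt : K -> K -> Prop) P :
  is_regular_cardinal K lt -> le_card nat K -> full_size K P <-> unbounded lt P.
Proof.
move=> [cK reg] nK; have [[irr [tr [tot wf]]] card] := cK; split=> [full a|ub].
  apply: contrapT => na; apply: (initial_segment_small (a := a) cK nK).
  apply: le_card_trans full (le_card_sub (f := id) _ _) => // b Pb ab.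
  by apply: na; exists b.
by apply: reg => a; have [b [Pb ab]] := ub a; exists b; split=> // ba;
   apply: irr (tr _ _ _ ab ba).
Qed.

(** * Closure points of a function and the largest one up to a given point *)

Definition closed_under (K : Type) (lt : K -> K -> Prop) (g : K -> K) (d : K) :=
  forall b, lt b d -> lt (g b) d.

(** Each [c (S n)] bounds the [g]-images of all points up to [c n]; the least strict upper bound of
    the sequence exists by regularity and uncountability, and is closed. *)
Lemma closed_under_unbounded (K : Type) (lt : K -> K -> Prop) g a :
  is_regular_cardinal K lt -> le_card nat K -> ~ le_card K nat ->
  exists d, closed_under lt g d /\ lt a d.
Proof.
move=> rK nK Kn; have [cK _] := rK; have [[irr [tr [tot wf]]] _] := cK.
have /choice[next nextP] c : exists c', lt c c' /\ forall b, ~ lt c b -> lt (g b) c'.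
  have sc := initial_segment_small (a := c) cK nK.
  have [s1 h1] := bounded_family (fun b => g (proj1_sig b)) rK sc.
  have [s2 h2] := bounded_family (fun b => proj1_sig b) rK sc.
  have hg b : ~ lt c b -> lt (g b) s1 by move=> nb; apply: (h1 (exist _ b nb)).
  have hc : lt c s2 by apply: (h2 (exist _ c (irr c))).
  case: (tot s1 s2) => [h|[h|h]].
  - by exists s2; split=> // b /hg h'; apply: tr h' h.
  - by exists s2; split=> // b /hg; rewrite h.
  - by exists s1; split=> //; apply: tr hc h.
pose c n := Nat.iter n next a.
have [s sc] := bounded_family c rK Kn.
have [d [dc dmin]] := wf_min wf (ex_intro (fun s => forall n, lt (c n) s) s sc).
exists d; split; last exact: (dc 0).
move=> b bd; apply: contrapT => ngd; apply: (dmin b _ bd) => n.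
apply: contrapT => ncb; apply: ngd; apply: tr (dc (S n)).
by apply: (nextP (c n)).2.
Qed.

(** The value [s = f_g(a)] of the introduction. *)
Definition is_floor (K : Type) (lt : K -> K -> Prop) (g : K -> K) (a s : K) :=
  [/\ ~ lt a s, closed_under lt g s &
      forall d, closed_under lt g d -> ~ lt a d -> ~ lt s d].

(** The least upper bound of the closure points up to [a] is itself a closure point. *)
Lemma floor_exists (K : Type) (lt : K -> K -> Prop) g a :
  strict_well_order K lt -> exists s, is_floor lt g a s.
Proof.
move=> [irr [tr [tot wf]]].
have [|s [sub smin]] :=
  @wf_min _ _ (fun s => forall d, closed_under lt g d -> ~ lt a d -> ~ lt s d) wf.
  by exists a.
exists s; split=> //; first by move=> as_; apply: (smin a) as_.
move=> b bs; apply: contrapT => ngb; apply: (smin b) (bs) => d cd nad bd.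
apply: ngb; case: (tot s d) => [/sub|[->|ds]]; [by case|exact: cd|].
exact: tr (cd _ bd) ds.
Qed.

Lemma floor_mono (K : Type) (lt : K -> K -> Prop) g g' a b s s' :
  strict_well_order K lt -> (forall c, ~ lt (g' c) (g c)) -> ~ lt b a ->
  is_floor lt g b s -> is_floor lt g' a s' -> ~ lt s s'.
Proof.
move=> [irr [tr [tot wf]]] gg' ba [_ _ smax] [as' cs' _].
apply: smax => [c cs|bs'].
  have := cs' c cs; case: (tot (g c) (g' c)) => [h h'|[->//|/gg' //]]; exact: tr h h'.
by case: (tot a b) => [ab|[e|//]]; apply: as'; [apply: tr ab bs'|rewrite e].
Qed.

(** Closure points of [g'] are closure points of [g], so those up to [a] and those up to [b] are
    both the ones up to [s]. *)
Lemma floor_eq (K : Type) (lt : K -> K -> Prop) g g' a b s s1 s2 :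
  strict_well_order K lt -> (forall c, ~ lt (g' c) (g c)) ->
  is_floor lt g a s -> is_floor lt g b s ->
  is_floor lt g' a s1 -> is_floor lt g' b s2 -> s1 = s2.
Proof.
move=> wo gg'; have [irr [tr [tot wf]]] := wo.
have key a' b' t1 t2 : is_floor lt g a' s -> is_floor lt g b' s ->
    is_floor lt g' a' t1 -> is_floor lt g' b' t2 -> ~ lt t2 t1.
  move=> fa fb fa' [_ _ t2max].
  have st1 := floor_mono wo gg' (@irr a') fa fa'.
  have [_ c1 _] := fa'; have [nbs _ _] := fb.
  apply: t2max => // bt1; case: (tot s b') => [sb|[e|//]].
    exact: st1 (tr _ _ _ sb bt1).
  by apply: st1; rewrite e.
move=> fa fb fa' fb'; case: (tot s1 s2) => [h|[//|h]].
  by case: (key _ _ _ _ fb fa fb' fa').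
by case: (key _ _ _ _ fa fb fa' fb').
Qed.

(** A closure point in [(a, b]] would lie above [g a], hence above [b]. *)
Lemma floor_interval (K : Type) (lt : K -> K -> Prop) g a b s t :
  strict_well_order K lt -> lt a b -> lt b (g a) ->
  is_floor lt g a s -> is_floor lt g b t -> t = s.
Proof.
move=> wo ab bga fa fb; have [irr [tr [tot wf]]] := wo.
have nba : ~ lt b a by move=> ba; apply: irr (tr _ _ _ ab ba).
have nts := floor_mono wo (fun c => @irr (g c)) nba fb fa.
case: (tot t s) => [/nts //|[//|st]].
have [_ _ smax] := fa; have [nbt ct _] := fb.
case: (smax t ct _ st) => /ct gat.
exact: nbt (tr _ _ _ bga gat).
Qed.

(* d(kappa) <= r(kappa): every unreaped family F in [kappa]^kappa admits a
   dominating family of size <= |F|. *)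
Theorem theorem3p8 (K : Type) (lt : K -> K -> Prop) :
  is_regular_cardinal K lt ->
  (forall n : nat, le_card (beth n) K) ->
  forall F : (K -> Prop) -> Prop,
    unreaped_family K F ->
    exists G : (K -> K) -> Prop,
      dominating K lt G /\ le_card {f : K -> K | G f} {A : K -> Prop | F A}.
Proof.
move=> rK big F [Ffull nreap].
have [cK _] := rK; have [wo _] := cK; have [irr [tr [tot wf]]] := wo.
have nK : le_card nat K := big 0.
have small X : sub_beth_omega X -> ~ le_card K X.
  move=> [m hm] KX; apply: (@cantor (beth m)).
  exact: le_card_trans (big (S m)) (le_card_trans KX hm).
have Kn : ~ le_card K nat := small _ (sub_beth_omega_beth 0).
have fullP P := full_size_unbounded P rK nK.
apply: contrapT => nG.
pose I := sig F.
have iI : inhabited I.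
  apply: contrapT => nI; apply: nreap; exists (fun=> True) => A FA.
  by case: nI; constructor; exists A.
have Iub (a : I) : unbounded lt (proj1_sig a) by case: a => A FA; apply/fullP; apply: Ffull.
have undom (G : I -> K -> K) : exists g, forall a, unbounded lt (fun b => lt (G a b) (g b)).
  apply: contrapT => ng; apply: nG; exists (fun f => exists a, G a = f); split.
    move=> g; apply: contrapT => nf; apply: ng; exists g => a.
    apply/fullP; apply: contrapT => nfull; apply: nf; exists (G a).
    by split; first by exists a.
  exact: le_card_range.
have [fl flP] : exists fl : (K -> K) -> K -> K, forall g a, is_floor lt g a (fl g a).
  have [f fP] := choice (fun p : (K -> K) * K => floor_exists (fst p) (snd p) wo).
  by exists (fun g a => f (g, a)) => g a; apply: (fP (g, a)).
have /choice[step stepP] g : exists g', (forall b, ~ lt (g' b) (g b)) /\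
    forall a : I, unbounded lt (fun c => proj1_sig a c /\ lt (fl g' c) (fl g c)).
  have /choice[w wP] (p : I * K) : exists c, proj1_sig (fst p) c /\ lt (snd p) (fl g c).
    have [d [cd bd]] := closed_under_unbounded g (snd p) rK nK Kn.
    have [c [ac dc]] := Iub (fst p) d; exists c; split=> //.
    have [_ _ cmax] := flP g c.
    have ncd : ~ lt c d by move=> cd'; apply: irr (tr _ _ _ dc cd').
    by case: (tot (fl g c) d) => [/(cmax d cd ncd)//|[->//|h]]; apply: tr bd h.
  (* If [g1 b] exceeds [fl g c] for [c = w (a, b)], where [b] is below [fl g c], then [fl g c] is
     not closed under any [g'] above [g1], and the floor of [c] drops. *)
  have [g1 g1P] := undom (fun a b => fl g (w (a, b))).
  pose g' b := if pselect (lt (g b) (g1 b)) then g1 b else g b.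
  have g'g b : ~ lt (g' b) (g b).
    rewrite /g'; case: (pselect (lt (g b) (g1 b))) => [h h'|h]; last exact: irr.
    exact: irr (tr _ _ _ h h').
  have g'g1 b : ~ lt (g' b) (g1 b).
    by rewrite /g'; case: (pselect (lt (g b) (g1 b))) => [h|h //]; apply: irr.
  exists g'; split=> // a e; have [b [hb eb]] := g1P a e.
  have [ac bc] := wP (a, b); rewrite /= in ac bc.
  set c := w (a, b) in ac bc hb; exists c.
  have [nc cc cmax] := flP g c; have [nc' cc' cmax'] := flP g' c.
  split; last first.
    apply: (tr _ _ _ eb); case: (tot (fl g c) c) => [|[<-//|//]]; exact: tr bc.
  split=> //; case: (tot (fl g' c) (fl g c)) => [//|[e'|]]; last first.
    by move/(floor_mono wo g'g (@irr c) (flP g c) (flP g' c)).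
  rewrite e' in cc'; have h := tr _ _ _ (cc' b bc) hb.
  by case: (g'g1 b).
(* The set where the floor drops meets every member of [F] in full size. As it does not reap [F],
   some member lies in it from a point on. *)
have /choice[cap capP] g : exists p : I * K, forall c, proj1_sig (fst p) c -> lt (snd p) c ->
    lt (fl (step g) c) (fl g c).
  apply: contrapT => np; apply: nreap.
  exists (fun c => lt (fl (step g) c) (fl g c)) => A FA; split; apply/fullP.
    exact: ((stepP g).2 (exist _ A FA)).
  move=> e; apply: contrapT => ne; apply: np; exists (exist _ A FA, e) => c /= Ac ec.
  by apply: contrapT => nl; apply: ne; exists c.
have [n [S [Ssm Scov]]] := coverable_all iI.
have /choice[H HP] (p : I * K) : exists h, forall A : I, S (fst p) A ->
    exists c, [/\ proj1_sig A c, lt (snd p) c & lt c h].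
  have /choice[c cP] (A : I) := Iub A (snd p).
  have [h hP] := bounded_family (fun A => c (proj1_sig A)) rK (small _ (Ssm (fst p))).
  exists h => A SA; exists (c A); split; [exact: (cP A).1|exact: (cP A).2|].
  exact: (hP (exist _ A SA)).
have [g0 g0P] := undom (fun a b => H (a, b)).
have [prec woX] := zermelo (beth (Datatypes.S n)).
have [irrX [trX [totX wfX]]] := woX.
have [g gP] : exists g : beth (Datatypes.S n) -> K -> K, forall x b,
    lt (g0 b) (g x b) /\ forall y, prec y x -> lt (step (g y) b) (g x b).
  have iK : inhabited K by have [f _] := nK; constructor; exact: (f 0).
  have [g gE] := wf_recursion wfX (fun x (rec : forall y, prec y x -> K -> K) b =>
    epsilon iK (fun s => lt (g0 b) s /\ forall y (h : prec y x), lt (step (rec y h) b) s)).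
  exists g => x b; rewrite gE.
  apply: (epsilon_spec iK (fun s => lt (g0 b) s /\ forall y, prec y x -> lt (step (g y) b) s)).
  have [s sP] := bounded_family (fun y => if pselect (prec y x) then step (g y) b else g0 b)
    rK (small _ (sub_beth_omega_beth (Datatypes.S n))).
  exists s; split.
    by have := sP x; case: (pselect (prec x x)) => [p|//]; case: (irrX x p).
  by move=> y yx; have := sP y; case: (pselect (prec y x)).
have [v vP] := Scov _ (fun x => fst (cap (g x))).
(* Otherwise each [z] serves countably many [x], and [beth (S n)] would inject into
   [beth n * nat]. *)
have [z zinf] : exists z, le_card nat {x | S (v z) (fst (cap (g x)))}.
  apply: contrapT => /forallNP nz.
  have /choice[zeta zetaP] := vP.
  have fib z : le_card {x | zeta x = z} nat.
    case: (le_card_total {x | S (v z) (fst (cap (g x)))} nat) => [h|/nz //].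
    by apply: le_card_trans (le_card_sub (f := id) _ _) h => // x <-.
  apply: (@cantor (beth n)).
  case: (le_card_of_prod (nat_le_beth n) (le_card_fibers fib)) => // h.
  exact: le_card_trans h (nat_le_beth n).
have [eta etaP] := bounded_family (fun x => snd (cap (g x))) rK
  (small _ (sub_beth_omega_beth (Datatypes.S n))).
have [b [Hb eb]] := g0P (v z) eta.
(* At this single [b], beyond all thresholds [snd (cap (g x))], the floors are to decrease along
   infinitely many [x]. *)
apply: (no_infinite_decreasing (phi := fun x => fl (g x) b) woX wf _ zinf).
have asym c d : lt c d -> ~ lt d c by move=> h h'; apply: irr (tr _ _ _ h h').
move=> x y Sx Sy xy.
have [c [Ac bc cH]] := HP (v z, b) _ Sx; rewrite /= in bc cH.
(* The point [c] of the captured set lies between [b] and [g0 b], so [b] and [c] have the same floor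
   for [g0], hence for [g x] and for [step (g x)]. The drop at [c] thereby becomes a drop at [b]. *)
have eq0 := floor_interval wo bc (tr _ _ _ cH Hb) (flP g0 b) (flP g0 c).
have g0x d : ~ lt (g x d) (g0 d) by apply/asym/(gP x d).1.
have f0c := flP g0 c; rewrite eq0 in f0c.
have eqx := floor_eq wo g0x f0c (flP g0 b) (flP (g x) c) (flP (g x) b).
have fxc := flP (g x) c; rewrite eqx in fxc.
have eqs := floor_eq wo (stepP (g x)).1 fxc (flP (g x) b)
  (flP (step (g x)) c) (flP (step (g x)) b).
have := capP (g x) c Ac (tr _ _ _ (etaP x) (tr _ _ _ eb bc)).
rewrite eqs eqx => desc.
have gxy d : ~ lt (g y d) (step (g x) d) by apply/asym/(gP y d).2.
have := floor_mono wo gxy (@irr b) (flP (step (g x)) b) (flP (g y) b).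
by case: (tot (fl (g y) b) (fl (step (g x)) b)) => [h _|[->//|//]]; apply: tr h desc.
Qed.
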